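(* Let $\mathcal H$ and $\mathcal H_\varepsilon$ ($\varepsilon>0$) be Hilbert spaces, let $A_\varepsilon$ and $A$ be closed operators on $\mathcal H_\varepsilon$ and $\mathcal H$ respectively, and assume that $A_\varepsilon$ converges to $A$ in the extended norm resolvent sense as $\varepsilon\to0$, with reference point $z_0\in\bigcap_{\varepsilon>0}\rho(A_\varepsilon)\cap\rho(A)$. Then the following hold. (i) If $\rho(A)$ is connected, then for every compact $K\subset\rho(A)$ there exists $\varepsilon_0>0$ such that $K\subset\rho(A_\varepsilon)$ for all $\varepsilon\in(0,\varepsilon_0)$. (ii) Assume that $K\subset\mathbb C$ is compact and connected, that $K\subset\rho(A_\varepsilon)$ for all $\varepsilon>0$, and that there is a constant $C$ with $\|(z-A_\varepsilon)^{-1}\|_{L(\mathcal H_\varepsilon)}\le C$ for all $\varepsilon>0$ and $z\in K$. Assume further that $K$ can be connected to $\{z_0\}$ by a curve $\gamma$ lying in $\rho(A_\varepsilon)$ for all $\varepsilon>0$. Then $K\subset\rho(A)$. (iii) For every isolated point $\lambda\in\sigma(A)$ such that, for some $\delta>0$, $B_\delta(\lambda)\setminus\{\lambda\}$ is in the same connected component of $\rho(A)$ as $z_0$, there exists a sequence $\lambda_\varepsilon\in\sigma(A_\varepsilon)$ such that $\lambda_\varepsilon\to\lambda$ as $\varepsilon\to0$.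
   Context: For $\varepsilon>0$ let $\mathcal H,\mathcal H_\varepsilon$ be Hilbert spaces and let $A_\varepsilon:\mathcal H_\varepsilon\supset\operatorname{dom}(A_\varepsilon)\to\mathcal H_\varepsilon$ and $A:\mathcal H\supset\operatorname{dom}(A)\to\mathcal H$ be closed operators. No relation between $\mathcal H$ and $\mathcal H_\varepsilon$ is assumed except through the operators below. $\rho(\cdot)$ and $\sigma(\cdot)$ denote resolvent set and spectrum; $L(X,Y)$ denotes bounded linear operators from $X$ to $Y$ with the operator norm, $L(X)=L(X,X)$; $B_\delta(\lambda)$ is the open disc in $\mathbb C$ of radius $\delta$ about $\lambda$. Let $\mathcal V_\varepsilon:=\operatorname{dom}(A_\varepsilon)$ with the graph norm $\|u\|_{\mathcal V_\varepsilon}:=\|u\|_{\mathcal H_\varepsilon}+\|A_\varepsilon u\|_{\mathcal H_\varepsilon}$. Definition (extended norm resolvent convergence). Assume that there exist $z_0\in\bigcap_{\varepsilon>0}\rho(A_\varepsilon)\cap\rho(A)$ and (linear) operators $J_\varepsilon:\mathcal H_\varepsilon\to\mathcal H$ and $I_\varepsilon:\mathcal H\to\mathcal H_\varepsilon$ such that (i) $\|I_\varepsilon J_\varepsilon-\mathrm{id}_{\mathcal H_\varepsilon}\|_{L(\mathcal V_\varepsilon,\mathcal H_\varepsilon)}\to0$ as $\varepsilon\to0$; (ii) $J_\varepsilon I_\varepsilon\to\mathrm{id}_{\mathcal H}$ strongly as $\varepsilon\to0$; (iii) $\|I_\varepsilon\|_{L(\mathcal H,\mathcal H_\varepsilon)},\|J_\varepsilon\|_{L(\mathcal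 H_\varepsilon,\mathcal H)}\le M$ for some $M>0$ uniformly in $\varepsilon$; (iv) $\|J_\varepsilon(z_0\,\mathrm{id}_{\mathcal H_\varepsilon}-A_\varepsilon)^{-1}-(z_0\,\mathrm{id}_{\mathcal H}-A)^{-1}J_\varepsilon\|_{L(\mathcal H_\varepsilon,\mathcal H)}\to0$ as $\varepsilon\to0$. Then $(A_\varepsilon)$ is said to converge to $A$ in the extended norm resolvent sense. *)

(* Defs.v *)
From HB Require Import structures.
From mathcomp Require Import all_boot all_order all_algebra.
From mathcomp Require Import sesquilinear.
From mathcomp Require Import complex.
From mathcomp Require Import all_classical all_reals all_analysis.

Set Implicit Arguments.
Unset Strict Implicit.
Unset Printing Implicit Defensive.

Import Order.TTheory GRing.Theory Num.Theory.
Import numFieldNormedType.Exports.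

Local Open Scope classical_set_scope.
Local Open Scope ring_scope.
Local Open Scope complex_scope.

(* [R[i]] carries no topology in the libraries; it gets that of its norm. *)
HB.instance Definition _ (R : realType) := NormedModule.copy R[i] R[i]^o.

(* A complex Hilbert space: complete for the norm given by an inner product,
   which is linear in its first argument. *)
HB.mixin Record CompleteNormedModule_isHilbert (R : realType) V
    of CompleteNormedModule R[i] V := {
  inner : {dot V for (@Num.conj R[i])} ;
  inner_normE : forall x : V, `|x| ^+ 2 = inner x x
}.

#[short(type="hilbertType")]
HB.structure Definition Hilbert (R : realType) :=
  {V of CompleteNormedModule_isHilbert R V & CompleteNormedModule R[i] V}.

Section Operators.
Context {R : realType}.

(* The library norm of a normed module over [R[i]] has values in [R[i]];
   [hnorm] is the same number seen in [R]. *)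
Definition hnorm (V : normedModType R[i]) (x : V) : R := complex.Re `|x|.

(* Norm in [L((D, N), Y)] of the restriction of [T] to the subspace [D]
   normed by [N]; it is [+oo] when [T] is unbounded. *)
Definition opnorm_on (X : Type) (Y : normedModType R[i])
    (D : set X) (N : X -> R) (T : X -> Y) : \bar R :=
  ereal_sup [set (hnorm (T x))%:E | x in [set x | D x /\ N x <= 1]].

Definition opnorm (X Y : normedModType R[i]) (T : X -> Y) : \bar R :=
  opnorm_on setT (@hnorm X) T.

(* A linear operator defined on the subspace [dom] only: the values of the
   underlying function outside [dom] are irrelevant. *)
Record unbounded_operator (H : lmodType R[i]) := UnboundedOperator {
  dom : set H ;
  op_fun :> H -> H ;
  dom0 : dom 0 ;
  dom_linear : forall (a : R[i]) x y, dom x -> dom y -> dom (a *: x + y) ;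
  op_linear : forall (a : R[i]) x y, dom x -> dom y ->
    op_fun (a *: x + y) = a *: op_fun x + op_fun y
}.

Section SpectralTheory.
Context {H : normedModType R[i]} (A : unbounded_operator H).

Definition closed_operator : Prop :=
  closed [set p : H * H | dom A p.1 /\ p.2 = A p.1].

Definition graph_norm (u : H) : R := hnorm u + hnorm (A u).

Definition shifted (z : R[i]) (u : H) : H := z *: u - A u.

(* [(z - A)^-1], meaningful when [z - A] is a bijection from [dom A] to [H]. *)
Definition resolvent (z : R[i]) : H -> H :=
  'pinv_(fun=> 0) (dom A) (shifted z).

Definition resolvent_set : set R[i] :=
  [set z | set_bij (dom A) setT (shifted z) /\ (opnorm (resolvent z) < +oo)%E].

Definition spectrum : set R[i] := ~` resolvent_set.

End SpectralTheory.

(* Extended norm resolvent convergence of [A_ e] to [A] as [e] tends to 0 from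
   the right, with reference point [z0]. The families are indexed by all of [R]
   but only their members with [0 < e] matter. *)
Definition ext_norm_resolvent_cvg (H : hilbertType R) (H_ : R -> hilbertType R)
    (A : unbounded_operator H) (A_ : forall e : R, unbounded_operator (H_ e))
    (z0 : R[i]) : Prop :=
  [/\ resolvent_set A z0,
      forall e : R, 0 < e -> resolvent_set (A_ e) z0 &
      exists (J : forall e : R, {linear H_ e -> H})
             (I : forall e : R, {linear H -> H_ e}),
      [/\ opnorm_on (dom (A_ e)) (graph_norm (A_ e))
            (fun u => I e (J e u) - u) @[e --> 0^'+] --> 0%E,
          forall x : H, J e (I e x) @[e --> 0^'+] --> x,
          exists2 M : R, 0 < M & forall e : R, 0 < e ->
            (opnorm (I e) <= M%:E)%E /\ (opnorm (J e) <= M%:E)%E &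
          opnorm (fun u => J e (resolvent (A_ e) z0 u)
                           - resolvent A z0 (J e u)) @[e --> 0^'+] --> 0%E]].

End Operators.

(* Main.v *)
Require Import Defs.
From mathcomp Require Import all_boot all_order all_algebra.
From mathcomp Require Import complex.
From mathcomp Require Import all_classical all_reals all_analysis.
From mathcomp Require Import ring lra.

Set Implicit Arguments.
Unset Strict Implicit.
Unset Printing Implicit Defensive.

Import Order.TTheory GRing.Theory Num.Theory.
Import numFieldNormedType.Exports.

Local Open Scope classical_set_scope.
Local Open Scope ring_scope.
Local Open Scope complex_scope.

(** Everything is read off from estimates on graphs. Write [T_e] and [T] for
    the resolvents of [A_ e] and [A] at [z0]; the hypotheses say that
    [J T_e - T J] and [(I J - 1) T_e] are small in norm, but [J I - 1] only
    strongly. Two facts follow.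

    - [bounded_below_approx]: if [z] is in the resolvent set of [A], the lower
      bound for [z - A] passes to [z - A_ e] for small [e]. Indeed [u] in the
      domain of [A_ e] is close to [I x], where [x = T J (z0 - A_ e) u], and
      [(z - A) x] is close to [J (z - A_ e) u]. Surjectivity does
      not pass over in the same way: comparing [T_e I] with [I T] would need
      [J I] to converge in norm.

    - [spectrum_approx]: if [z] is in the spectrum of [A], then the resolvents
      of the [A_ e] at [z] cannot exist with a common bound for arbitrarily
      small [e]. Indeed such a bound gives a lower bound for [z - A], because
      every point of the graph of [A] is a limit of points of the graphs of
      the [A_ e] ([graph_approx]), and it gives a dense range, because
      [T J (z0 - A_ e) (z - A_ e)^-1 I f] solves [(z - A) x = f] up to an
      error tending to 0; the range of [z - A] is closed.

    The second fact contains the second assertion.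

    For the first assertion, surjectivity is propagated by continuity in [z]:
    by the uniform lower bound, a small disc around a point of the resolvent
    set of [A] lies in that of [A_ e] as soon as it meets it. Hence the
    region of boundedness of the family is open and relatively closed in the
    resolvent set of [A], and contains the component of [z0]
    ([component_boundedness_region]). Compactness does the rest.

    For the third assertion, the resolvents of the [A_ e] are uniformly
    bounded on a small circle around [lambda]. If [A_ e] had no spectrum inside, the
    maximum principle for [w |-> |(w - A_ e)^-1 f|] would extend the bound to
    [lambda], contradicting [spectrum_approx]. The maximum principle
    ([resolvent_maximum_principle]) is obtained without contour integrals, by
    averaging the resolvent over the four points [z + t i^k]. *)

(** * The norm with values in the reals *)

Section RealNorm.
Context {R : realType}.
Implicit Type V : normedModType R[i].

Lemma hnormE V (x : V) : `|x| = (hnorm x)%:C.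
Proof. by rewrite /hnorm RRe_real// normr_real. Qed.

Lemma hnorm_ge0 V (x : V) : 0 <= hnorm x.
Proof. by have := normr_ge0 x; rewrite hnormE ler0c. Qed.

Lemma hnorm0 V : hnorm (0 : V) = 0.
Proof. by rewrite /hnorm normr0. Qed.

Lemma hnorm0_eq0 V (x : V) : hnorm x = 0 -> x = 0.
Proof. by move=> x0; apply: normr0_eq0; rewrite hnormE x0. Qed.

Lemma hnormN V (x : V) : hnorm (- x) = hnorm x.
Proof. by rewrite /hnorm normrN. Qed.

Lemma hdistC V (x y : V) : hnorm (x - y) = hnorm (y - x).
Proof. by rewrite -hnormN opprB. Qed.

Lemma hnormD V (x y : V) : hnorm (x + y) <= hnorm x + hnorm y.
Proof. by have := ler_normD x y; rewrite !hnormE -rmorphD lecR. Qed.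

Lemma hnormB V (x y : V) : hnorm (x - y) <= hnorm x + hnorm y.
Proof. by rewrite -(hnormN y) hnormD. Qed.

Lemma hdist_triangle V (x y z : V) :
  hnorm (x - z) <= hnorm (x - y) + hnorm (y - z).
Proof. by rewrite -(subrKA y) hnormD. Qed.

Lemma hnormZ V (a : R[i]) (x : V) : hnorm (a *: x) = hnorm a * hnorm x.
Proof. by have := normrZ a x; rewrite !hnormE -rmorphM => -[]. Qed.

Lemma hnormM (a b : R[i]) : hnorm (a * b) = hnorm a * hnorm b.
Proof. by have := normrM a b; rewrite !hnormE -rmorphM => -[]. Qed.

Lemma hnorm_real (t : R) : hnorm t%:C = `|t|.
Proof. by rewrite /hnorm normc_def/= expr0n addr0 sqrtr_sqr. Qed.

Lemma hnorm_i : hnorm ('i%C : R[i]) = 1.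
Proof. by rewrite /hnorm normc_def/= expr0n/= expr1n add0r sqrtr1. Qed.

Lemma hnorm_sqr (z : R[i]) : hnorm z ^+ 2 = complex.Re z ^+ 2 + complex.Im z ^+ 2.
Proof.
by rewrite /hnorm normc_def/= sqr_sqrtr// addr_ge0// sqr_ge0.
Qed.

Lemma gt0_complexE (e : R[i]) :
  0 < e -> 0 < complex.Re e /\ e = (complex.Re e)%:C.
Proof.
by move=> e0; rewrite RRe_real ?gtr0_real//; move: e0; rewrite ltcE => /andP[].
Qed.

Lemma nbhs_hnormP V (x : V) (P : set V) :
  nbhs x P <-> exists2 r : R, 0 < r & forall y, hnorm (y - x) < r -> P y.
Proof.
split=> [/nbhs_ballP[e e0 eP]|[r r0 rP]].
  have [re0 er] := gt0_complexE e0; exists (complex.Re e) => // y yx.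
  by apply: eP; rewrite -ball_normE/= hnormE er ltcR hdistC.
apply/nbhs_ballP; exists r%:C => /=; first by rewrite ltcR.
by move=> y; rewrite -ball_normE/= hnormE ltcR hdistC => /rP.
Qed.

Lemma cvg_hnormP V (T : Type) (F : set_system T) (FF : Filter F)
    (f : T -> V) (l : V) :
  f @ F --> l <-> forall r : R, 0 < r -> \forall t \near F, hnorm (f t - l) < r.
Proof.
split=> [fl r r0|fl].
  by apply: (fl [set y | hnorm (y - l) < r]); apply/nbhs_hnormP; exists r.
move=> P /nbhs_hnormP[r r0 rP]; rewrite nbhs_filterE/=.
by apply: filterS (fl _ r0) => t /rP.
Qed.

Lemma hcauchy_cvg (V : completeNormedModType R[i]) (u : nat -> V) :
  (forall r : R, 0 < r -> \forall n \near \oo,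
     forall m, (n <= m)%N -> hnorm (u m - u n) < r) ->
  exists l : V, u @ \oo --> l.
Proof.
move=> uC; suff /cauchy_cvg uc : cauchy (u @ \oo) by exists (lim (u @ \oo)).
apply: (cauchy_exP (u @ \oo)) => e e0; have [re0 er] := gt0_complexE e0.
have [N _ /(_ N (leqnn _)) uN] := uC _ re0; exists (u N).
by exists N => // m /= /uN; rewrite -ball_normE/= hnormE er ltcR hdistC.
Qed.

End RealNorm.

(** * Operator norms *)

Section OperatorNorm.
Context {R : realType}.

Lemma opnorm_onP {X : Type} {Y : normedModType R[i]} {D : set X} {N : X -> R}
    {T : X -> Y} {c : R} :
  (opnorm_on D N T <= c%:E)%E <->
  (forall x, D x -> N x <= 1 -> hnorm (T x) <= c).
Proof.
split=> [Tc x Dx Nx|Tc].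
  by rewrite -lee_fin (le_trans _ Tc)//; apply: ereal_sup_ubound; exists x.
by apply: ge_ereal_sup => _ [x [Dx Nx] <-]; rewrite lee_fin Tc.
Qed.

(** Passing from the unit ball to all of [D] by scaling; radii strictly larger
    than [N x] also settle the case [N x = 0]. *)
Lemma opnorm_on_bound {X : lmodType R[i]} {Y : normedModType R[i]}
    {D : set X} {N : X -> R} {T : X -> Y} {c : R} :
  (forall (t : R) x, D x -> D (t%:C *: x)) ->
  (forall x, D x -> 0 <= N x) ->
  (forall (t : R) x, D x -> 0 <= t -> N (t%:C *: x) = t * N x) ->
  (forall (t : R) x, D x -> T (t%:C *: x) = t%:C *: T x) ->
  (opnorm_on D N T <= c%:E)%E -> forall x, D x -> hnorm (T x) <= c * N x.
Proof.
move=> DZ N0 NZ TZ /opnorm_onP Tc x Dx.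
have key s : N x < s -> hnorm (T x) <= c * s.
  move=> Nxs; have s0 : 0 < s := le_lt_trans (N0 _ Dx) Nxs.
  have := Tc (s^-1%:C *: x) (DZ _ _ Dx).
  have si0 : 0 <= s^-1 by rewrite invr_ge0 ltW.
  rewrite NZ// TZ// hnormZ hnorm_real ger0_norm//.
  by rewrite ![s^-1 * _]mulrC !ler_pdivrMr// mul1r; apply; exact: ltW.
have [c0|c0] := leP c 0.
  have /key : N x < N x + 1 by rewrite ltrDl.
  by have := hnorm_ge0 (T x); have := N0 x Dx; nra.
apply/ler_addgt0Pr => e e0; have /key : N x < N x + e / c by rewrite ltrDl divr_gt0.
by rewrite mulrDr [c * (e / c)]mulrC divfK ?gt_eqF.
Qed.

Lemma opnorm_bound {X Y : normedModType R[i]} {T : X -> Y} {c : R} :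
  (forall (t : R) x, T (t%:C *: x) = t%:C *: T x) ->
  (opnorm T <= c%:E)%E -> forall x, hnorm (T x) <= c * hnorm x.
Proof.
move=> TZ Tc x; apply: (opnorm_on_bound _ _ _ _ Tc) => //= [? _|t y _ t0].
- exact: hnorm_ge0.
- by rewrite hnormZ hnorm_real ger0_norm.
Qed.

Lemma cvge0_near {T : Type} {F : set_system T} {FF : Filter F} {f : T -> \bar R} :
  f @ F --> 0%E -> forall tau : R, 0 < tau ->
  \forall t \near F, (f t <= tau%:E)%E.
Proof.
move=> f0 tau tau0.
have : nbhs (0%E : \bar R) [set y | (y < tau%:E)%E].
  by apply: open_ereal_lt'; rewrite lte_fin.
by move=> /f0; apply: (@filterS _ F) => t /= /ltW.
Qed.

End OperatorNorm.

(** * Resolvents and lower bounds *)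

Section Resolvent.
Context {R : realType} {H : normedModType R[i]} (A : unbounded_operator H).
Implicit Types (z w : R[i]) (u v f : H) (c : R).

Lemma domZ (a : R[i]) u : dom A u -> dom A (a *: u).
Proof.
by move=> Au; have := dom_linear a Au (dom0 A); rewrite addr0.
Qed.

Lemma domD u v : dom A u -> dom A v -> dom A (u + v).
Proof. by move=> Au Av; have := dom_linear 1 Au Av; rewrite scale1r. Qed.

Lemma domB u v : dom A u -> dom A v -> dom A (u - v).
Proof. by move=> Au Av; rewrite -scaleN1r; apply: domD => //; apply: domZ. Qed.

Lemma shiftedD z u v : dom A u -> dom A v ->
  shifted A z (u + v) = shifted A z u + shifted A z v.
Proof.
move=> Au Av; have := op_linear 1 Au Av; rewrite !scale1r /shifted => ->.
by rewrite scalerDr opprD addrACA.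
Qed.

Lemma op0 : A 0 = 0.
Proof.
have := op_linear 1 (dom0 A) (dom0 A).
by rewrite !scale1r addr0 -[LHS]addr0 => /addrI <-.
Qed.

Lemma opZ (a : R[i]) u : dom A u -> A (a *: u) = a *: A u.
Proof. by move=> Au; have := op_linear a Au (dom0 A); rewrite op0 !addr0. Qed.

Lemma shiftedZ z (a : R[i]) u : dom A u ->
  shifted A z (a *: u) = a *: shifted A z u.
Proof.
by move=> Au; rewrite /shifted opZ// scalerBr !scalerA mulrC.
Qed.

Lemma shiftedB z u v : dom A u -> dom A v ->
  shifted A z (u - v) = shifted A z u - shifted A z v.
Proof.
move=> Au Av; rewrite -scaleN1r shiftedD//; last exact: domZ.
by rewrite shiftedZ// scaleN1r.
Qed.

Lemma shifted_change w z u : shifted A z u = shifted A w u + (z - w) *: u.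
Proof. by rewrite /shifted scalerBl [RHS]addrC subrKA. Qed.

(** The resolvent bound [|(z - A)^-1| <= c], stated on the domain so that it
    makes sense before [z - A] is known to be onto. *)
Definition bounded_below z c :=
  forall u, dom A u -> hnorm u <= c * hnorm (shifted A z u).

Lemma bounded_belowW z c c' : c <= c' -> bounded_below z c -> bounded_below z c'.
Proof.
by move=> cc' zc u /zc/le_trans; apply; rewrite ler_wpM2r// hnorm_ge0.
Qed.

Lemma resolvent_dom z f : resolvent_set A z -> dom A (resolvent A z f).
Proof.
by move=> [[Ah Ai As] _]; have [+ _ _] := bijpinv_bij (fun=> 0) (And3 Ah Ai As); apply.
Qed.

Lemma shifted_resolvent z f :
  resolvent_set A z -> shifted A z (resolvent A z f) = f.
Proof.
by move=> [[_ _ As] _]; rewrite /resolvent (surjpK _ As)// in_setT.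
Qed.

Lemma resolvent_shifted z u :
  resolvent_set A z -> dom A u -> resolvent A z (shifted A z u) = u.
Proof.
by move=> [[_ Ai _] _] Au; rewrite /resolvent pinvKV// inE.
Qed.

Lemma resolventZ z (a : R[i]) f : resolvent_set A z ->
  resolvent A z (a *: f) = a *: resolvent A z f.
Proof.
move=> rz; have Af := resolvent_dom f rz.
rewrite -{1}(shifted_resolvent f rz) -shiftedZ// resolvent_shifted//.
exact: domZ.
Qed.

Lemma resolvent_unique z u f :
  resolvent_set A z -> dom A u -> shifted A z u = f -> resolvent A z f = u.
Proof. by move=> rz Au <-; rewrite resolvent_shifted. Qed.

Lemma resolventB z f g : resolvent_set A z ->
  resolvent A z (f - g) = resolvent A z f - resolvent A z g.
Proof.
move=> rz; apply: resolvent_unique => //.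
  by apply: domB; apply: resolvent_dom.
by rewrite shiftedB ?shifted_resolvent//; apply: resolvent_dom.
Qed.

Lemma opnorm_resolvent_bounded_below z c : resolvent_set A z ->
  (opnorm (resolvent A z) <= c%:E)%E -> bounded_below z c.
Proof.
move=> rz zc u Au; rewrite -{1}(resolvent_shifted rz Au).
by apply: (opnorm_bound _ zc) => t x; rewrite resolventZ.
Qed.

Lemma resolvent_set_bounded_below z : resolvent_set A z ->
  exists2 c, 0 < c & bounded_below z c.
Proof.
move=> /[dup] rz [_ fin].
have [c zc] : exists c : R, (opnorm (resolvent A z) <= c%:E)%E.
  move: fin; case: (opnorm _) => [c _| //|_]; first by exists c.
  by exists 0; rewrite leNye.
exists (Num.max c 1); first by rewrite lt_max ltr01 orbT.
apply: (@bounded_belowW _ c); first by rewrite le_max lexx.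
exact: opnorm_resolvent_bounded_below.
Qed.

Lemma resolvent_norm z c f : resolvent_set A z -> bounded_below z c ->
  hnorm (resolvent A z f) <= c * hnorm f.
Proof.
move=> rz zc; have := zc _ (resolvent_dom f rz).
by rewrite shifted_resolvent.
Qed.

Lemma bounded_below_surj z c : 0 <= c -> bounded_below z c ->
  (forall f, exists2 u, dom A u & shifted A z u = f) -> resolvent_set A z.
Proof.
move=> c0 zc zs.
have bij : set_bij (dom A) setT (shifted A z).
  split=> [//|u v|f _]; last by have [u Au <-] := zs f; exists u.
  rewrite !inE => Au Av uv; apply/subr0_eq/hnorm0_eq0/eqP.
  rewrite eq_le hnorm_ge0 andbT (le_trans (zc _ (domB Au Av)))//.
  by rewrite shiftedB// uv subrr hnorm0 mulr0.
split=> //; apply: (@le_lt_trans _ _ c%:E); last exact: ltry.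
apply/opnorm_onP => f _ f1.
have As : set_surj (dom A) setT (shifted A z) by case: bij.
have [Ah _ _] := bijpinv_bij (fun=> 0 : H) bij.
have := zc (resolvent A z f) (Ah f I).
rewrite [shifted A z _](surjpK _ As) ?in_setT// => /le_trans; apply.
by rewrite -[leRHS]mulr1 ler_wpM2l.
Qed.

End Resolvent.

(** * Closed operators and perturbation of the resolvent *)

Section ClosedOperator.
Context {R : realType} {H : completeNormedModType R[i]}.
Context (A : unbounded_operator H).
Implicit Types (z w : R[i]) (u f : H) (c : R).

(** Closed range: preimages of a convergent sequence in the range form a Cauchy
    sequence by the lower bound, and closedness identifies the limit. *)
Lemma bounded_below_dense_surj z c : closed_operator A ->
  0 < c -> bounded_below A z c ->
  (forall f (tau : R), 0 < tau ->
     exists2 u, dom A u & hnorm (shifted A z u - f) < tau) ->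
  resolvent_set A z.
Proof.
move=> clA c0 zc dense; apply: (bounded_below_surj (ltW c0) zc) => f.
have inv0 n : 0 < n.+1%:R^-1 :> R by rewrite invr_gt0.
pose u n := sval (cid2 (dense f n.+1%:R^-1 (inv0 n))).
have Au n : dom A (u n) by rewrite /u; case: cid2.
have uf n : hnorm (shifted A z (u n) - f) < n.+1%:R^-1.
  by rewrite /u; case: cid2.
have near_inv (r : R) : 0 < r -> \forall n \near \oo,
    forall m, (n <= m)%N -> m.+1%:R^-1 < r :> R.
  move=> r0; exists (Num.bound r^-1) => // n /= rn m nm.
  rewrite -[r]invrK ltf_pV2 ?posrE ?invr_gt0//.
  apply: (lt_le_trans (archi_boundP _)); first by rewrite invr_ge0 ltW.
  by rewrite ler_nat (leq_trans rn)// (leq_trans nm).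
have suf : (fun n => shifted A z (u n)) @ \oo --> f.
  apply/cvg_hnormP => r r0; apply: filterS (near_inv r r0) => n rn.
  exact: lt_trans (uf n) (rn n (leqnn n)).
have [l ul] : exists l : H, u @ \oo --> l.
  apply: hcauchy_cvg => r r0.
  have r2 : 0 < r / (2 * c) by rewrite divr_gt0// mulr_gt0.
  apply: filterS (near_inv _ r2) => n rn m nm.
  apply: (le_lt_trans (zc _ (domB (Au m) (Au n)))); rewrite shiftedB//.
  have := hdist_triangle (shifted A z (u m)) f (shifted A z (u n)).
  rewrite (hdistC f (shifted A z (u n))) => tri.
  have un := lt_trans (uf n) (rn n (leqnn n)).
  have um := lt_trans (uf m) (rn m nm).
  rewrite mulrC -ltr_pdivlMr//; apply: (le_lt_trans tri).
  have -> : r / c = r / (2 * c) + r / (2 * c) by field; lra.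
  exact: ltrD.
have Aul : (fun n => (u n, A (u n))) @ \oo --> (l, z *: l - f).
  apply: cvg_pair => //=.
  have -> : (fun n => A (u n)) = (fun n => z *: u n - shifted A z (u n)).
    by apply/funext => n; rewrite /shifted subKr.
  by apply: cvgB => //; apply: cvgZ => //; exact: cvg_cst.
have [Al lA] : dom A l /\ z *: l - f = A l.
  apply: (closed_cvg (fun p : H * H => dom A p.1 /\ p.2 = A p.1) clA _ _ Aul).
  by apply: nearW => n; split; first exact: Au.
by exists l => //; rewrite /shifted -lA subKr.
Qed.

Lemma bounded_below_near z w c : 0 <= c -> hnorm (w - z) * c <= 2^-1 ->
  bounded_below A z c -> bounded_below A w (2 * c).
Proof.
move=> c0 wz zc u Au; have := zc u Au.
rewrite (shifted_change A w) => h.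
have := hnormD (shifted A w u) ((z - w) *: u).
rewrite hnormZ (hdistC z) => h2.
have u0 := hnorm_ge0 u; have := ler_wpM2r u0 wz.
have := ler_wpM2l c0 h2; lra.
Qed.

(** The Neumann series in the guise of successive approximation: replacing
    [u] by [u + (z - A)^-1 (f - (w - A) u)] halves the residual. *)
Lemma resolvent_set_near z w c : closed_operator A -> 0 < c ->
  resolvent_set A z -> bounded_below A z c ->
  hnorm (w - z) * c <= 2^-1 -> resolvent_set A w.
Proof.
move=> clA c0 rz zc wz.
apply: (@bounded_below_dense_surj w (2 * c)) => //.
- by rewrite mulr_gt0.
- exact: bounded_below_near (ltW c0) wz zc.
move=> f tau tau0.
have approx n : exists2 u, dom A u & hnorm (shifted A w u - f) <= 2^-1 ^+ n * hnorm f.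
  elim: n => [|n [u Au uf]].
    exists 0; first exact: dom0.
    by rewrite /shifted scaler0 op0 !sub0r oppr0 add0r hnormN mul1r.
  set g := f - shifted A w u; have Ag := resolvent_dom g rz.
  exists (u + resolvent A z g); first exact: domD.
  rewrite shiftedD// [shifted A w (resolvent _ _ _)](shifted_change A z).
  rewrite shifted_resolvent// /g addrA subrKC -addrAC subrr add0r hnormZ.
  have := resolvent_norm g rz zc; have := hnorm_ge0 g.
  rewrite /g (hdistC f) -/g exprS => g0 h.
  have := ler_wpM2l (hnorm_ge0 (w - z)) h.
  by have := ler_wpM2r g0 wz; lra.
have [u Au uf] := approx (Num.bound (hnorm f / tau)); exists u => //.
apply: (le_lt_trans uf); rewrite exprVn mulrC ltr_pdivrMr ?exprn_gt0//.
by rewrite mulrC -ltr_pdivrMr// upper_nthrootP.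
Qed.

End ClosedOperator.

(** * Discs and circles in the complex plane *)

Section Disc.
Context {R : realType}.
Implicit Types (l w : R[i]) (r : R).

Lemma hdist_continuous l : continuous (fun w : R[i] => hnorm (w - l)).
Proof.
move=> w P /nbhs_ballP[tau /= tau0 tauP].
apply/(@nbhs_hnormP _ R[i]); exists tau => // v vw; apply: tauP.
rewrite -ball_normE/=; apply: le_lt_trans vw.
rewrite ler_norml; apply/andP; split.
  by rewrite lerBrDr addrC -lerBrDr opprK; have := hdist_triangle v w l; lra.
by have := hdist_triangle w v l; rewrite (hdistC w v); lra.
Qed.

Lemma compact_disc l r : compact [set w | hnorm (w - l) <= r].
Proof.
pose g (p : R * R) : R[i] := l + (p.1 +i* p.2).
have gc : continuous g.
  move=> p; apply/(@cvg_hnormP _ R[i] _ (nbhs p)) => tau tau0.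
  have tau2 : 0 < tau / 2 by rewrite divr_gt0.
  exists (ball p.1 (tau / 2), ball p.2 (tau / 2)) => /=.
    by split; exact: nbhsx_ballx.
  move=> [x y] /= [xp yp].
  have -> : g (x, y) - g p = (x - p.1)%:C + 'i%C * (y - p.2)%:C.
    rewrite /g /= opprD addrACA subrr add0r; simpc; congr (_ +i* _); lra.
  apply: (le_lt_trans (hnormD _ _)); rewrite hnormM !hnorm_real.
  rewrite hnorm_i mul1r; move: xp yp; rewrite -!ball_normE/=.
  rewrite ![`|p.1 - _|]distrC ![`|p.2 - _|]distrC.
  by lra.
apply: (@subclosed_compact _ _ (g @` (`[- r, r] `*` `[- r, r]))).
- have -> : [set w | hnorm (w - l) <= r] =
      (fun w => hnorm (w - l)) @^-1` [set x | x <= r] by [].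
  by apply: preimage_closed; [move=> ? _; exact: hdist_continuous|exact: closed_le].
- apply: continuous_compact; first exact: continuous_subspaceT.
  by apply: compact_setX; exact: segment_compact.
move=> w /= wr; have r0 : 0 <= r := le_trans (hnorm_ge0 _) wr.
exists (complex.Re (w - l), complex.Im (w - l)) => /=; last first.
  by rewrite /g/=; case: (w - l) (subrKC l w).
have := hnorm_sqr (w - l); have := hnorm_ge0 (w - l).
move: wr; move: (hnorm _) (complex.Re _) (complex.Im _) => a x y ar a0 axy.
by rewrite !in_itv/=; split; apply/andP; split; nra.
Qed.

Lemma compact_circle l r : compact [set w | hnorm (w - l) = r].
Proof.
apply: (subclosed_compact _ (@compact_disc l r)); last by move=> w /= ->.
have -> : [set w | hnorm (w - l) = r] = (fun w => hnorm (w - l)) @^-1` [set r].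
  by [].
by apply: preimage_closed; [move=> ? _; exact: hdist_continuous|exact: closed_eq].
Qed.

End Disc.

(** * A maximum principle for the resolvent *)

Section MaximumPrinciple.
Context {R : realType} {H : completeNormedModType R[i]}.
Context (A : unbounded_operator H).
Implicit Types (z w l : R[i]) (u f : H) (c s r t : R).

Definition four_points t : seq R[i] :=
  [:: t%:C; 'i%C * t%:C; - t%:C; - ('i%C * t%:C)].

Lemma hnorm_four_points t w : 0 <= t -> w \in four_points t -> hnorm w = t.
Proof.
move=> t0; rewrite !inE => /or4P[]/eqP->;
  rewrite ?hnormN ?hnormM ?hnorm_i ?mul1r hnorm_real; exact: ger0_norm.
Qed.

Lemma four_points4 t w : w \in four_points t -> w ^+ 4 = (t ^+ 4)%:C.
Proof.
have i4 : ('i%C : R[i]) ^+ 4 = 1.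
  by rewrite -[4%N]/(2 * 2)%N exprM sqr_i sqrrN expr1n.
have tX : (t%:C : R[i]) ^+ 4 = (t ^+ 4)%:C by rewrite rmorphXn.
have iX : ('i%C * t%:C : R[i]) ^+ 4 = (t ^+ 4)%:C by rewrite exprMn i4 mul1r.
have NX (x : R[i]) : (- x) ^+ 4 = x ^+ 4 by ring.
by rewrite !inE => /or4P[]/eqP->; rewrite ?NX ?iX ?tX.
Qed.

Lemma four_points_sum t (j : nat) : (0 < j < 4)%N ->
  \sum_(w <- four_points t) w ^+ j = 0.
Proof.
rewrite /four_points !big_cons big_nil; have i2 := sqr_i R.
case: j => [//|[|[|[|//]]]] _.
- by ring.
- by rewrite [LHS](_ : _ = 2 * t%:C ^+ 2 * (1 + 'i%C ^+ 2)); [rewrite i2 subrr mulr0|ring].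
- by ring.
Qed.

(** A discrete mean value inequality, with an error of order [t^4]: averaging
    over the four points kills the terms of order 1, 2 and 3 of the Neumann
    expansion at [z]. Two points would leave an error of order [t^2], too large
    against the gain [kappa t^2] in the maximum principle. *)
Lemma resolvent_four_points z t s f : 0 <= t -> 0 <= s ->
  resolvent_set A z -> bounded_below A z s ->
  (forall w, hnorm w = t -> resolvent_set A (z + w)) ->
  4 * hnorm (resolvent A z f) <= (1 + (t * s) ^+ 4) *
    \sum_(w <- four_points t) hnorm (resolvent A (z + w) f).
Proof.
move=> t0 s0 rz zs rw.
pose S := resolvent A z; pose v w := resolvent A (z + w) f.
have SB a b : S (a - b) = S a - S b by exact: resolventB.
have SZ (k : R[i]) a : S (k *: a) = k *: S a by exact: resolventZ.
have SN a : S (- a) = - S a by rewrite -scaleN1r SZ scaleN1r.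
have SD a b : S (a + b) = S a + S b by rewrite -{1}[b]opprK SB SN opprK.
have S0 : S 0 = 0 by have := SB 0 0; rewrite !subrr.
have Sb a : hnorm (S a) <= s * hnorm a := resolvent_norm a rz zs.
have vE w : w \in four_points t -> v w = S f - w *: S (v w).
  move=> wt; have r := rw w (hnorm_four_points t0 wt).
  have Av : dom A (v w) by exact: resolvent_dom.
  rewrite -SZ -SB; apply/esym/resolvent_unique => //.
  by rewrite (shifted_change _ (z + w)) shifted_resolvent// opprD addNKr scaleNr.
have vE4 w : w \in four_points t -> v w = S f - w ^+ 1 *: S (S f)
    + w ^+ 2 *: S (S (S f)) - w ^+ 3 *: S (S (S (S f)))
    + (t ^+ 4)%:C *: S (S (S (S (v w)))).
  move=> wt; rewrite -(four_points4 wt).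
  (* four steps of the resolvent identity [v w = S f - w S (v w)] *)
  rewrite {1}(vE w wt) {1}(vE w wt) {1}(vE w wt) {1}(vE w wt).
  rewrite !(SB, SZ) !scalerBr !exprS expr0 !mulr1 -!scalerA.
  by rewrite !opprD !opprK !addrA.
have Ssum : S (S (S (S (\sum_(w <- four_points t) v w)))) =
    \sum_(w <- four_points t) S (S (S (S (v w)))).
  by rewrite !(big_morph S SD S0).
set V := \sum_(w <- four_points t) v w.
have VE : V = 4 *: S f + (t ^+ 4)%:C *: S (S (S (S V))).
  rewrite Ssum {1}/V (eq_big_seq _ vE4) !big_split/= !sumrN -!scaler_suml.
  rewrite !four_points_sum// !scale0r subr0 addr0 subr0 -scaler_sumr.
  congr (_ + _); rewrite big_const_seq count_predT /=.
  by rewrite scaler_nat !mulrS mulr0n.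
have Vb : hnorm V <= \sum_(w <- four_points t) hnorm (v w).
  rewrite /V; elim/big_rec2 : _ => [|w a b _ ab]; first by rewrite hnorm0.
  by apply: (le_trans (hnormD _ _)); rewrite lerD2l.
have SVb : hnorm (S (S (S (S V)))) <= s ^+ 4 * hnorm V.
  rewrite !exprS expr0 mulr1 -!mulrA.
  by do 4 (apply: (le_trans (Sb _)); rewrite ler_wpM2l//).
have -> : 4 * hnorm (resolvent A z f) = hnorm (V - (t ^+ 4)%:C *: S (S (S (S V)))).
  rewrite {1}VE addrK hnormZ; congr (_ * _).
  by rewrite -[4]/(4%:R) -(rmorph_nat (real_complex R)) hnorm_real normr_nat.
apply: (le_trans (hnormB _ _)); rewrite hnormZ hnorm_real.
rewrite ger0_norm ?exprn_ge0// exprMn.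
have := ler_wpM2l (exprn_ge0 4 t0) SVb.
have p0 : 0 <= t ^+ 4 * s ^+ 4 by rewrite mulr_ge0 ?exprn_ge0.
by have := ler_wpM2l p0 Vb; rewrite -/V; lra.
Qed.

Lemma four_points_sqr t z : \sum_(w <- four_points t) hnorm (z + w) ^+ 2 =
  4 * (hnorm z ^+ 2 + t ^+ 2).
Proof.
rewrite /four_points !big_cons big_nil !hnorm_sqr.
by case: z => x y; simpc => /=; ring.
Qed.

Lemma resolvent_hnorm_continuous f z : closed_operator A ->
  resolvent_set A z -> {for z, continuous (fun w => hnorm (resolvent A w f))}.
Proof.
move=> clA rz P /nbhs_ballP[tau /= tau0 tauP].
have [s s0 zs] := resolvent_set_bounded_below rz.
pose q := 2 * s * s * hnorm f + tau.
have q0 : 0 < q by rewrite ltr_wpDl// !mulr_ge0 ?hnorm_ge0// ltW.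
apply/(@nbhs_hnormP _ R[i]).
exists (Num.min (2 * s)^-1 (tau / q)).
  by rewrite lt_min invr_gt0 mulr_gt0//= divr_gt0.
move=> w; rewrite lt_min => /andP[wz1 wz2].
have wzs : hnorm (w - z) * s <= 2^-1.
  apply: (@le_trans _ _ ((2 * s)^-1 * s)); first by rewrite ler_pM2r// ltW.
  by rewrite invfM mulfVK ?gt_eqF.
have rw : resolvent_set A w by exact: resolvent_set_near rz zs wzs.
have ws := bounded_below_near (ltW s0) wzs zs.
apply: tauP; rewrite -ball_normE/=.
set u := resolvent A z f; set v := resolvent A w f.
have uv : hnorm (u - v) <= s * (hnorm (w - z) * (2 * s * hnorm f)).
  have Au : dom A u by exact: resolvent_dom.
  have Av : dom A v by exact: resolvent_dom.
  apply: (le_trans (zs _ (domB Au Av))); rewrite ler_pM2l//.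
  rewrite shiftedB// [shifted A z v](shifted_change A w) !shifted_resolvent//.
  rewrite opprD addNKr hnormN hnormZ (hdistC z) ler_wpM2l ?hnorm_ge0//.
  exact: resolvent_norm.
have f0 := hnorm_ge0 f.
have wzq : hnorm (w - z) * q < tau by rewrite -ltr_pdivlMr.
have uv' : hnorm (u - v) < tau.
  have : 0 <= hnorm (w - z) * tau by rewrite mulr_ge0 ?hnorm_ge0// ltW.
  by move: wzq uv; rewrite /q; lra.
apply: le_lt_trans uv'; rewrite ler_norml; apply/andP; split.
  by have := hnormD (v - u) u; rewrite subrK (hdistC v); lra.
by have := hnormD (u - v) v; rewrite subrK; lra.
Qed.

(** The function [w |-> |(w - A)^-1 f| + kappa |w - l|^2] cannot have an
    interior maximum: by [resolvent_four_points], its mean over the points at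
    distance [t] of a given point exceeds its value there by
    [kappa t^2 - O(t^4)]. *)
Lemma resolvent_maximum_principle l r c : closed_operator A -> 0 < r ->
  (forall w, hnorm (w - l) <= r -> resolvent_set A w) ->
  (forall w, hnorm (w - l) = r -> bounded_below A w c) ->
  bounded_below A l c.
Proof.
move=> clA r0 rD rC u Au; set f := shifted A l u.
have rl : resolvent_set A l by apply: rD; rewrite subrr hnorm0 ltW.
have -> : u = resolvent A l f by rewrite resolvent_shifted.
apply/ler_addgt0Pr => eta eta0.
pose kappa := eta / r ^+ 2; have k0 : 0 < kappa by rewrite divr_gt0// exprn_gt0.
pose phi w := hnorm (resolvent A w f).
pose psi w := phi w + kappa * hnorm (w - l) ^+ 2.
pose D := [set w | hnorm (w - l) <= r].
have Dl : D l by rewrite /D/= subrr hnorm0 ltW.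
have psic : {within D, continuous psi}.
  apply: continuous_in_subspaceT => w; rewrite inE => /rD rw.
  apply: continuousD; first exact: resolvent_hnorm_continuous.
  apply: continuousM; first exact: cst_continuous.
  apply: (@continuous_comp _ _ _ (fun w => hnorm (w - l)) (fun x : R => x ^+ 2)).
    exact: hdist_continuous.
  exact: exprn_continuous.
have [z zD zmax] := compact_EVT_max (ex_intro _ l Dl) (@compact_disc _ l r) psic.
rewrite inE in zD.
have psil : phi l <= psi z.
  apply: (@le_trans _ _ (psi l)); last by apply: zmax; rewrite inE.
  by rewrite lerDl mulr_ge0 ?sqr_ge0// ltW.
have rz := rD z zD.
have [zr|zr] := eqVneq (hnorm (z - l)) r.
  apply: (le_trans psil); rewrite /psi /kappa zr divfK ?gt_eqF ?exprn_gt0//.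
  by rewrite lerD2r; apply: resolvent_norm => //; exact: rC.
have {}zr : hnorm (z - l) < r by rewrite lt_neqAle zr.
exfalso.
have [s s0 zs] := resolvent_set_bounded_below rz.
(* [t <= 1] and [t q <= kappa] force the fourth order error of the mean value
   inequality, [t^4 s^4 phi z], below the gain [kappa t^2] *)
pose q := s ^+ 4 * phi z + kappa.
have q0 : 0 < q.
  by rewrite ltr_wpDl// mulr_ge0 ?hnorm_ge0// exprn_ge0// ltW.
pose t := Num.min (Num.min 1 (r - hnorm (z - l))) (kappa / q).
have t0 : 0 < t by rewrite !lt_min ltr01 subr_gt0 zr divr_gt0.
have t1 : t <= 1 by rewrite !ge_min lexx.
have tr : t <= r - hnorm (z - l) by rewrite !ge_min lexx !orbT.
have tq : t * q <= kappa by rewrite -ler_pdivlMr// ge_min lexx orbT.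
have Dw w : hnorm w = t -> D (z + w).
  by move=> wt; rewrite /D/= addrAC (le_trans (hnormD _ _))// wt; lra.
have := resolvent_four_points f (ltW t0) (ltW s0) rz zs (fun w wt => rD _ (Dw w wt)).
have sum_phi : \sum_(w <- four_points t) phi (z + w) <= 4 * (phi z - kappa * t ^+ 2).
  have : \sum_(w <- four_points t) psi (z + w) <= 4 * psi z.
    rewrite big_seq.
    apply: (@le_trans _ _ (\sum_(w <- four_points t | w \in four_points t) psi z)).
      apply: ler_sum => w wt; apply: zmax; rewrite inE; apply: Dw.
      exact: hnorm_four_points (ltW t0) wt.
    by rewrite -big_seq /four_points !big_cons big_nil; lra.
  rewrite big_split/= -mulr_sumr.
  under [X in _ + kappa * X]eq_bigr do rewrite addrAC.
  by rewrite four_points_sqr /psi; lra.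
have p0 : 0 <= (t * s) ^+ 4 by rewrite exprn_ge0// mulr_ge0// ltW.
have := ler_wpM2l (addr_ge0 ler01 p0) sum_phi.
rewrite -/(phi z) => h1 h2.
have {}h1 := le_trans h2 h1.
have phi0 : 0 <= phi z by exact: hnorm_ge0.
have h3 : kappa * t ^+ 2 <= (t * s) ^+ 4 * phi z.
  have : 0 <= (t * s) ^+ 4 * (kappa * t ^+ 2).
    by rewrite mulr_ge0// mulr_ge0 ?sqr_ge0// ltW.
  lra.
have h4 : (t * s) ^+ 4 * phi z <= t ^+ 2 * (t * (s ^+ 4 * phi z)).
  have -> : (t * s) ^+ 4 * phi z = t ^+ 3 * (s ^+ 4 * phi z) * t by ring.
  have -> : t ^+ 2 * (t * (s ^+ 4 * phi z)) = t ^+ 3 * (s ^+ 4 * phi z) by ring.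
  by rewrite ler_piMr// mulr_ge0 ?exprn_ge0 ?mulr_ge0 ?exprn_ge0// ltW.
have t2 : 0 < t ^+ 2 by rewrite exprn_gt0.
have := le_trans h3 h4; rewrite mulrC ler_pM2l// => h5.
have : t * (s ^+ 4 * phi z) < t * q by rewrite ltr_pM2l// ltrDl.
by lra.
Qed.

End MaximumPrinciple.

(** * Estimates transferred between the operators and their limit *)

Section Approximation.
Context {R : realType} {H : hilbertType R} {H_ : R -> hilbertType R}.
Context (A : unbounded_operator H) (A_ : forall e : R, unbounded_operator (H_ e)).
Context (z0 : R[i]) (J : forall e : R, {linear H_ e -> H})
  (I : forall e : R, {linear H -> H_ e}) (M : R).
Hypothesis clA : closed_operator A.
Hypothesis clA_ : forall e : R, 0 < e -> closed_operator (A_ e).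
Hypothesis rAz0 : resolvent_set A z0.
Hypothesis rA_z0 : forall e : R, 0 < e -> resolvent_set (A_ e) z0.
Hypothesis M_gt0 : 0 < M.
Hypothesis I_bound : forall (e : R) (x : H), 0 < e -> hnorm (I e x) <= M * hnorm x.
Hypothesis J_bound : forall (e : R) (u : H_ e), 0 < e -> hnorm (J e u) <= M * hnorm u.
Hypothesis IJ_cvg : forall tau : R, 0 < tau -> \forall e \near 0^'+,
  forall u, dom (A_ e) u -> hnorm (I e (J e u) - u) <= tau * graph_norm (A_ e) u.
Hypothesis JI_cvg : forall (x : H) (tau : R), 0 < tau -> \forall e \near 0^'+,
  hnorm (J e (I e x) - x) <= tau.
Hypothesis res_cvg : forall tau : R, 0 < tau -> \forall e \near 0^'+, forall f,
  hnorm (J e (resolvent (A_ e) z0 f) - resolvent A z0 (J e f)) <= tau * hnorm f.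

Lemma graph_norm_shifted (e : R) (z : R[i]) (u : H_ e) :
  graph_norm (A_ e) u <= (1 + hnorm z) * hnorm u + hnorm (shifted (A_ e) z u).
Proof.
have -> : graph_norm (A_ e) u = hnorm u + hnorm (z *: u - shifted (A_ e) z u).
  by rewrite /shifted subKr.
rewrite mulrDl mul1r -addrA lerD2l -hnormZ; exact: hnormB.
Qed.

(** With [x = (z0 - A)^-1 J (z0 - A_ e) u], the vectors [J u] and [x] are close,
    so [(z - A) x] is close to [J (z - A_ e) u], and [u] is close to [I J u]; all
    errors are small relative to the graph norm of [u], which the left-hand
    side absorbs. *)
Lemma bounded_below_approx z : resolvent_set A z ->
  exists2 c : R, 0 < c & \forall e \near 0^'+, bounded_below (A_ e) z c.
Proof.
move=> rz; have [k k0 zk] := resolvent_set_bounded_below rz.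
pose d := hnorm (z - z0); pose n := hnorm z.
have d0 : 0 <= d by exact: hnorm_ge0.
have n0 : 0 <= n by exact: hnorm_ge0.
pose p := M * (k * d + 1); have p0 : 0 < p.
  by rewrite mulr_gt0// ltr_wpDl// mulr_ge0// ltW.
(* with [tau] the tolerance in the hypotheses, the total error is at most
   [tau * Q * (|u| + |(z - A_ e) u|)] *)
pose Q := 1 + n + p * (d + 1).
have Q0 : 0 < Q.
  by have := mulr_ge0 (ltW p0) d0; rewrite /Q; lra.
exists (2 * (M * k * M) + 1); first by rewrite ltr_wpDl// !mulr_ge0// ltW.
pose tau := (2 * Q)^-1; have tau0 : 0 < tau by rewrite invr_gt0 mulr_gt0.
have tauQ : tau * Q = 2^-1 by rewrite /tau; field; lra.
apply: filterS (filterI (nbhs_right_gt 0) (filterI (IJ_cvg tau0) (res_cvg tau0))).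
move=> e [e0 [IJe rese]] u Au.
set g := shifted (A_ e) z u; set h := shifted (A_ e) z0 u.
set x := resolvent A z0 (J e h).
have Ax : dom A x by exact: resolvent_dom.
have ux : hnorm (J e u - x) <= tau * hnorm h.
  rewrite -{1}(resolvent_shifted (rA_z0 e0) Au).
  exact: rese.
have gh : g = h + (z - z0) *: u by rewrite /g (shifted_change _ z0).
have zx : shifted A z x = J e g - (z - z0) *: (J e u - x).
  rewrite (shifted_change _ z0) shifted_resolvent// gh (linearD (J e) h) linearZ/=.
  by rewrite scalerBr opprB addrACA subrr addr0.
have {zx} xb : hnorm x <= k * (M * hnorm g + d * (tau * hnorm h)).
  apply: (le_trans (zk x Ax)); rewrite ler_pM2l// zx.
  apply: (le_trans (hnormB _ _)); rewrite lerD ?J_bound// hnormZ.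
  by rewrite ler_wpM2l.
have hb : hnorm h <= hnorm g + d * hnorm u.
  have -> : h = g - (z - z0) *: u by rewrite gh addrK.
  by rewrite -hnormZ; exact: hnormB.
have := graph_norm_shifted z u; rewrite -/n -/g => gb.
have ub : hnorm u <= tau * graph_norm (A_ e) u + M * (hnorm x + tau * hnorm h).
  have := hnormB (I e (J e u)) (I e (J e u) - u); rewrite subKr => /le_trans.
  apply; rewrite addrC lerD ?IJe//.
  apply: (le_trans (I_bound _ e0)); rewrite ler_pM2l//.
  by rewrite -{1}[J e u](subrK x) addrC (le_trans (hnormD _ _))// lerD2l.
have := hnorm_ge0 u; have := hnorm_ge0 g.
move: xb hb gb ub; move: (hnorm u) (hnorm g) (hnorm h) (hnorm x) (graph_norm _ _).
move=> a b y s t xb hb gb ub b0 a0.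
have s1 : M * s <= M * k * M * b + M * k * d * tau * y.
  by rewrite -subr_ge0; have := ler_wpM2l (ltW M_gt0) xb; lra.
have s2 : tau * t <= tau * ((1 + n) * a + b) by rewrite ler_pM2l.
have s3 : p * tau * y <= p * tau * (b + d * a) by rewrite ler_pM2l// mulr_gt0.
have s4 : a <= M * k * M * b + tau * ((1 + n) * a + b) + p * tau * (b + d * a).
  by move: s1 s3; rewrite /p; lra.
have s5 : tau * ((1 + n) * a + b) + p * tau * (b + d * a) <= tau * Q * (a + b).
  have tau_ge0 := ltW tau0; have p_ge0 := ltW p0.
  have := mulr_ge0 (mulr_ge0 tau_ge0 p_ge0) a0.
  have := mulr_ge0 (mulr_ge0 (mulr_ge0 tau_ge0 p_ge0) d0) b0.
  have := mulr_ge0 (mulr_ge0 tau_ge0 n0) b0.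
  by rewrite /Q; lra.
by rewrite tauQ in s5; lra.
Qed.

(** Points of the graph of [A] are limits of points of the graphs of [A_ e]:
    the approximant of [x] solves [(z0 - A_ e) u = I (z0 - A) x]. *)
Lemma graph_approx x : dom A x -> forall tau : R, 0 < tau ->
  \forall e \near 0^'+, exists u, [/\ dom (A_ e) u,
    hnorm (J e u - x) <= tau, hnorm (u - I e x) <= tau &
    shifted (A_ e) z0 u = I e (shifted A z0 x)].
Proof.
move=> Ax; set y := shifted A z0 x.
have [k k0 z0k] := resolvent_set_bounded_below rAz0.
have [c c0 z0c] := bounded_below_approx rAz0.
pose b := M * hnorm y; have b0 : 0 <= b by rewrite mulr_ge0 ?hnorm_ge0 ?ltW.
pose n := hnorm z0; have n0 : 0 <= n by exact: hnorm_ge0.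
pose p := b + k; have p0 : 0 < p by rewrite ltr_wpDl.
pose q := M * p + ((1 + n) * c + 1) * b.
suff key (tau : R) : 0 < tau -> \forall e \near 0^'+, exists u, [/\ dom (A_ e) u,
    hnorm (J e u - x) <= p * tau, hnorm (u - I e x) <= q * tau &
    shifted (A_ e) z0 u = I e y].
  move=> tau tau0; have q0 : 0 <= q.
    have := mulr_ge0 (mulr_ge0 n0 (ltW c0)) b0; have := mulr_ge0 (ltW c0) b0.
    by have := mulr_ge0 (ltW M_gt0) (ltW p0); rewrite /q; lra.
  have s0 : 0 < p + q by rewrite ltr_pwDl.
  have := key (tau / (p + q)) (divr_gt0 tau0 s0).
  apply: filterS => e [u [Au Ju uI uy]]; exists u; split=> //.
    apply: (le_trans Ju); rewrite mulrC -mulrA ger_pMr// ler_pdivrMl//; lra.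
  apply: (le_trans uI); rewrite mulrC -mulrA ger_pMr// ler_pdivrMl//; lra.
move=> tau0; apply: filterS (filterI (nbhs_right_gt 0) (filterI (IJ_cvg tau0)
  (filterI (res_cvg tau0) (filterI (JI_cvg y tau0) z0c)))).
move=> e [e0 [IJe [rese [JIe z0ce]]]].
exists (resolvent (A_ e) z0 (I e y)); set u := resolvent _ _ _.
have Au : dom (A_ e) u by exact/resolvent_dom/rA_z0.
have uy : shifted (A_ e) z0 u = I e y by exact/shifted_resolvent/rA_z0.
have Iyb : hnorm (I e y) <= b by exact: I_bound.
have Ju : hnorm (J e u - x) <= p * tau.
  rewrite /p mulrDl.
  apply: (le_trans (hdist_triangle _ (resolvent A z0 (J e (I e y))) _)).
  apply: lerD.
    apply: (@le_trans _ _ (tau * hnorm (I e y))); last by rewrite mulrC ler_pM2r.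
    exact: rese.
  rewrite -(resolvent_shifted rAz0 Ax) -resolventB//.
  by apply: (le_trans (resolvent_norm _ rAz0 z0k)); rewrite ler_pM2l.
split=> //.
have IJu : hnorm (I e (J e u) - u) <= tau * (((1 + n) * c + 1) * b).
  apply: (@le_trans _ _ (tau * graph_norm (A_ e) u)).
    exact: IJe.
  rewrite ler_pM2l//; apply: (le_trans (graph_norm_shifted z0 u)); rewrite uy.
  have uc : hnorm u <= c * b.
    apply: (@le_trans _ _ (c * hnorm (I e y))); last by rewrite ler_pM2l.
    by rewrite -uy; exact: z0ce.
  have := ler_wpM2l (addr_ge0 ler01 n0) uc; rewrite -/n; lra.
apply: (le_trans (hdist_triangle _ (I e (J e u)) _)).
rewrite addrC /q mulrDl (hdistC u) [_ * b * tau]mulrC lerD//.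
rewrite -linearB -mulrA; apply: (le_trans (I_bound _ e0)).
by rewrite ler_pM2l.
Qed.

(** A common bound for the resolvents of the [A_ e] at [z], for arbitrarily
    small [e], puts [z] in the resolvent set of [A]: the lower bound passes to
    [A] along [graph_approx], and [(z0 - A)^-1 J (z0 - A_ e) v] with
    [v = (z - A_ e)^-1 I f] is an approximate solution of [(z - A) x = f]. *)
Lemma spectrum_approx z c : 0 < c -> spectrum A z ->
  \forall e \near 0^'+,
    ~ (resolvent_set (A_ e) z /\ bounded_below (A_ e) z c).
Proof.
move=> c0; apply: contra_notP => not_ev.
have freq (P : R -> Prop) : (\forall e \near 0^'+, P e) -> exists e : R,
    [/\ 0 < e, P e, resolvent_set (A_ e) z & bounded_below (A_ e) z c].
  move=> evP; apply: contrapT => noP; apply: not_ev.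
  apply: filterS (filterI (nbhs_right_gt 0) evP) => e [e0 Pe] [rz zc].
  by apply: noP; exists e; split.
pose d := hnorm (z - z0); have d0 : 0 <= d by exact: hnorm_ge0.
have zMc : bounded_below A z (M * c * M).
  move=> x Ax; apply/ler_addgt0Pr => eta eta0.
  pose q := 1 + M * c * d.
  have q0 : 0 < q by rewrite ltr_pwDl// !mulr_ge0// ltW.
  pose tau := eta / q; have tau0 : 0 < tau by rewrite divr_gt0.
  have [e [e0 [u [Au Ju uI uy]] rz zc]] := freq _ (graph_approx Ax tau0).
  have h1 : hnorm (shifted (A_ e) z u) <= M * hnorm (shifted A z x) + d * tau.
    have -> : shifted (A_ e) z u =
        I e (shifted A z x) + (z - z0) *: (u - I e x).
      rewrite !(shifted_change _ z0 z) uy (linearD (I e) (shifted A z0 x)).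
      rewrite linearZ/= scalerBr.
      by rewrite -addrA [X in _ = _ + X]addrC subrK.
    apply: (le_trans (hnormD _ _)); rewrite lerD ?I_bound// hnormZ.
    by rewrite ler_wpM2l.
  have h2 : hnorm x <= tau + M * hnorm u.
    have -> : x = (x - J e u) + J e u by rewrite subrK.
    by apply: (le_trans (hnormD _ _)); rewrite lerD ?J_bound// hdistC.
  have h3 := ler_wpM2l (ltW M_gt0) (zc u Au).
  have h4 : M * (c * hnorm (shifted (A_ e) z u)) <=
     M * (c * (M * hnorm (shifted A z x) + d * tau)).
    by rewrite !ler_pM2l.
  have h5 : q * tau = eta by rewrite /tau; field; lra.
  by move: h5; rewrite /q; lra.
apply: (bounded_below_dense_surj clA _ zMc); first by rewrite !mulr_gt0.
move=> f tau tau0.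
pose b := M * hnorm f; have b0 : 0 <= b by rewrite mulr_ge0 ?hnorm_ge0 ?ltW.
pose G := b + d * (c * b).
have G0 : 0 <= G := addr_ge0 b0 (mulr_ge0 d0 (mulr_ge0 (ltW c0) b0)).
pose eta := tau / 2 / (1 + d * G).
have q0 : 0 < 1 + d * G := ltr_pwDl ltr01 (mulr_ge0 d0 G0).
have eta0 : 0 < eta by rewrite !divr_gt0.
have [e [e0 [res JI] rz zc]] := freq _ (filterI (res_cvg eta0) (JI_cvg f eta0)).
set v := resolvent (A_ e) z (I e f).
have Av : dom (A_ e) v by exact: resolvent_dom.
set g := shifted (A_ e) z0 v.
have Ifg : I e f = g + (z - z0) *: v.
  by rewrite -(shifted_change (A_ e) z0) shifted_resolvent.
have Ifb : hnorm (I e f) <= b by exact: I_bound.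
have gG : hnorm g <= G.
  have -> : g = I e f - (z - z0) *: v by rewrite Ifg addrK.
  apply: (le_trans (hnormB _ _)); rewrite lerD// hnormZ ler_wpM2l//.
  by apply: (le_trans (resolvent_norm _ rz zc)); rewrite ler_pM2l.
set x := resolvent A z0 (J e g); exists x; first exact: resolvent_dom.
have xv : hnorm (x - J e v) <= eta * G.
  rewrite hdistC -[v](resolvent_shifted (rA_z0 e0) Av).
  by apply: (le_trans (res g)); rewrite ler_pM2l.
have -> : shifted A z x - f = (J e (I e f) - f) + (z - z0) *: (x - J e v).
  rewrite (shifted_change _ z0) shifted_resolvent// Ifg (linearD (J e) g) linearZ/=.
  by rewrite scalerBr [RHS]addrAC (addrACA (J e g)) subrr addr0.
apply: (le_lt_trans (hnormD _ _)); rewrite hnormZ -/d.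
have : d * hnorm (x - J e v) <= d * (eta * G) by rewrite ler_wpM2l.
have : (1 + d * G) * eta = tau / 2 by rewrite /eta; field; lra.
by move: JI; lra.
Qed.

(** * The region of boundedness *)

(** Kato's region of boundedness: near [z], the resolvents of the [A_ e] exist
    and are uniformly bounded for small [e]. The bound [p.2] is a second
    parameter tending to infinity, so that compactness yields a common one. *)
Definition boundedness_region : set R[i] :=
  [set z | \forall w \near z & p \near filter_prod (0^'+) (pinfty_nbhs R),
     resolvent_set (A_ p.1) w /\ bounded_below (A_ p.1) w p.2].

Lemma boundedness_region_compact (K : set R[i]) :
  compact K -> K `<=` boundedness_region ->
  exists2 c : R, 0 < c & \forall e \near 0^'+, forall w, K w ->
    resolvent_set (A_ e) w /\ bounded_below (A_ e) w c.
Proof.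
move=> /compact_near_coveringP cK Kreg.
have [[E C] /= [evE evC] EC] := cK _ (filter_prod (0^'+) (pinfty_nbhs R))
  (fun p w => resolvent_set (A_ p.1) w /\ bounded_below (A_ p.1) w p.2) _ Kreg.
have [c [c0 Cc]] : exists c : R, 0 < c /\ C c.
  exact: filter_ex (filterI (nbhs_pinfty_gt (num_real 0)) evC).
by exists c => //; apply: filterS evE => e Ee; exact: (EC (e, c)).
Qed.

Lemma boundedness_region_resolvent z : boundedness_region z ->
  \forall e \near 0^'+, resolvent_set (A_ e) z.
Proof.
move=> zreg; have [|c _] := boundedness_region_compact (@compact_set1 _ z).
  by move=> _ ->.
by apply: filterS => e /(_ z erefl)[].
Qed.

Lemma open_boundedness_region : open boundedness_region.
Proof.
rewrite openE => z [[U F] /= [zU evF] UF].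
by apply: filterS (nbhs_interior zU) => w wU; exists (U, F).
Qed.

(** Around a point of the resolvent set of [A], the lower bounds of
    [bounded_below_approx] prevent the resolvent sets of the [A_ e] from
    having a boundary. *)
Lemma boundedness_region_dichotomy z : resolvent_set A z ->
  closure boundedness_region z \/
    (\forall e \near 0^'+, resolvent_set (A_ e) z) ->
  boundedness_region z.
Proof.
move=> rz; have [c c0 evc] := bounded_below_approx rz.
(* two points of the disc are at distance at most [2 r] and share the bound
   [2 c], and [2 r * (2 c) = 1/2] allows a Neumann step from one to the other *)
pose r := (8 * c)^-1; have r0 : 0 < r by rewrite invr_gt0 mulr_gt0.
have rc : r * c = 8^-1 by rewrite /r invfM mulfVK ?gt_eqF.
pose U := [set w | hnorm (w - z) < r].
have zU : nbhs z U by apply/(@nbhs_hnormP _ R[i]); exists r.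
move=> zcl.
have [w Uw evw] : exists2 w, U w & \forall e \near 0^'+, resolvent_set (A_ e) w.
  case: zcl => [/(_ _ zU)[w [wreg Uw]]|evz].
    by exists w => //; exact: boundedness_region_resolvent.
  by exists z => //; exact: nbhs_singleton.
pose F := [set e : R | 0 < e /\ bounded_below (A_ e) z c /\ resolvent_set (A_ e) w].
have evF : \forall e \near 0^'+, F e.
  exact: (filterI (nbhs_right_gt 0) (filterI evc evw)).
exists (U, F `*` [set b | 2 * c < b]) => /=.
  split=> //; exists (F, [set b | 2 * c < b]) => //=; split=> //.
  exact: nbhs_pinfty_gt (num_real _).
move=> [v [e b]] /= [Uv [[e0 [zc rw]] cb]].
have lower v' : U v' -> bounded_below (A_ e) v' (2 * c).
  move=> Uv'; apply: bounded_below_near zc; first exact: ltW.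
  have : hnorm (v' - z) * c <= r * c by rewrite ler_pM2r// ltW.
  by rewrite rc; lra.
split; last by apply: bounded_belowW (lower v Uv); exact: ltW.
apply: (resolvent_set_near (clA_ e0) _ rw (lower w Uw)); first by rewrite mulr_gt0.
have vw : hnorm (v - w) <= 2 * r.
  have := hdist_triangle v z w; rewrite (hdistC z w).
  by move: Uv Uw; rewrite /U/=; lra.
have : hnorm (v - w) * (2 * c) <= 2 * r * (2 * c).
  by rewrite ler_pM2r// mulr_gt0.
by move: rc; lra.
Qed.

(** The region of boundedness is open and, by the dichotomy, relatively closed
    in the resolvent set of [A]; it contains [z0]. *)
Lemma component_boundedness_region :
  connected_component (resolvent_set A) z0 `<=` boundedness_region.
Proof.
set C := connected_component _ _.
have CA : C `<=` resolvent_set A by exact: connected_component_sub.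
have z0C : C z0 by exact: connected_component_refl.
have z0reg : boundedness_region z0.
  apply: boundedness_region_dichotomy => //; right.
  exact: filterS rA_z0 (nbhs_right_gt 0).
suff <- : C `&` boundedness_region = C by move=> z [].
apply: (component_connected (A := resolvent_set A) (x := z0)).
- by exists z0.
- by exists boundedness_region => //; exact: open_boundedness_region.
exists (closure boundedness_region); first exact: closed_closure.
apply/seteqP; split=> z [Cz zreg].
  exact: (conj Cz (subset_closure zreg)).
exact: (conj Cz (boundedness_region_dichotomy (CA z Cz) (or_introl zreg))).
Qed.

(** * Spectrum of the approximating operators near an isolated point *)

(** On a small circle around [l] the resolvents are bounded uniformly in [e];
    without spectrum inside the circle the maximum principle would carry this
    bound to [l], against [spectrum_approx]. *)
Lemma spectrum_near l (d : R) : spectrum A l -> 0 < d ->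
  (forall w, 0 < hnorm (w - l) < d -> connected_component (resolvent_set A) z0 w) ->
  forall eta : R, 0 < eta -> \forall e \near 0^'+,
    exists2 w, spectrum (A_ e) w & hnorm (w - l) <= eta.
Proof.
move=> sl d0 dC eta eta0.
pose r := Num.min eta (d / 2).
have r0 : 0 < r by rewrite lt_min eta0 divr_gt0.
have rd : r < d.
  by apply: (@le_lt_trans _ _ (d / 2)); [rewrite ge_min lexx orbT|lra].
have circle : [set w | hnorm (w - l) = r] `<=` boundedness_region.
  by move=> w /= wr; apply/component_boundedness_region/dC; rewrite wr r0.
have [c c0 evc] := boundedness_region_compact (@compact_circle _ l r) circle.
apply: filterS (filterI (nbhs_right_gt 0) (filterI evc (spectrum_approx c0 sl))).
move=> e [e0 [rc notl]]; apply: contrapT => nospec; apply: notl.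
have disc w : hnorm (w - l) <= r -> resolvent_set (A_ e) w.
  move=> wr; apply: contrapT => sw; apply: nospec; exists w => //.
  by apply: (le_trans wr); rewrite ge_min lexx.
split; first by apply: disc; rewrite subrr hnorm0 ltW.
apply: (resolvent_maximum_principle (clA_ e0) r0 disc) => w wr.
by have [] := rc w wr.
Qed.

End Approximation.

(** Minimizing the distance to [l] up to [e] gives one choice that serves every
    tolerance [eta]. *)
Lemma select_cvg {R : realType} (S : R -> set R[i]) (l : R[i]) :
  (forall eta : R, 0 < eta -> \forall e \near 0^'+,
     exists2 w, S e w & hnorm (w - l) <= eta) ->
  exists2 f : R -> R[i], \forall e \near 0^'+, S e (f e) & f e @[e --> 0^'+] --> l.
Proof.
move=> Sl.
pose best e := [set w | S e w /\ forall v, S e v -> hnorm (w - l) <= hnorm (v - l) + e].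
have ex_best e : 0 < e -> S e !=set0 -> exists w, best e w.
  move=> e0 [w Sw]; pose d := [set hnorm (v - l) | v in S e].
  have dinf : has_inf d.
    split; first by exists (hnorm (w - l)), w.
    by exists 0 => _ [v _ <-]; exact: hnorm_ge0.
  have [_ [v Sv <-] vd] := inf_adherent e0 dinf.
  exists v; split=> // v' Sv'; apply: (le_trans (ltW vd)).
  by rewrite lerD2r; apply: ge_inf; [case: dinf|exists v'].
pose f e := xget 0 (best e).
have near_best (eta : R) : 0 < eta ->
    \forall e \near 0^'+, S e (f e) /\ hnorm (f e - l) <= eta + e.
  move=> eta0; apply: filterS (filterI (nbhs_right_gt 0) (Sl _ eta0)).
  move=> e [e0 [w Sw wl]].
  have [v bv] := ex_best e e0 (ex_intro _ w Sw).
  have [Sf fl] : best e (f e) by rewrite /f; exact: xgetPex (ex_intro _ v bv).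
  by split=> //; apply: (le_trans (fl w Sw)); rewrite lerD2r.
exists f; first by apply: filterS (near_best 1 ltr01) => e [].
apply/(@cvg_hnormP _ R[i]) => r r0.
have r2 : 0 < r / 2 by rewrite divr_gt0.
apply: filterS (filterI (nbhs_right_lt r2) (near_best _ r2)) => e [er [_ fl]].
by lra.
Qed.

(** * Spectral convergence *)

Theorem theorem4 (R : realType) (H : hilbertType R) (H_ : R -> hilbertType R)
    (A : unbounded_operator H) (A_ : forall e : R, unbounded_operator (H_ e))
    (z0 : R[i])
    (clA : closed_operator A)
    (clA_ : forall e : R, 0 < e -> closed_operator (A_ e))
    (A_cvg : ext_norm_resolvent_cvg A A_ z0) :
  [/\ connected (resolvent_set A) ->
        forall K : set R[i], compact K -> K `<=` resolvent_set A ->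
        exists2 e0 : R, 0 < e0 &
          forall e : R, 0 < e < e0 -> K `<=` resolvent_set (A_ e),
      forall (K : set R[i]) (C : R) (gamma : R -> R[i]),
        compact K -> connected K ->
        (forall e : R, 0 < e -> K `<=` resolvent_set (A_ e)) ->
        (forall (e : R) (z : R[i]), 0 < e -> K z ->
           (opnorm (resolvent (A_ e) z) <= C%:E)%E) ->
        {within `[0, 1], continuous gamma} ->
        K (gamma 0) -> gamma 1 = z0 ->
        (forall (e t : R), 0 < e -> 0 <= t <= 1 ->
           resolvent_set (A_ e) (gamma t)) ->
        K `<=` resolvent_set A &
      forall lambda : R[i], isolated (spectrum A) lambda ->
        (exists2 d : R, 0 < d &
           ball lambda d%:C `\ lambda `<=`
             connected_component (resolvent_set A) z0) ->
        exists2 lambda_ : R -> R[i],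
          \forall e \near 0^'+, spectrum (A_ e) (lambda_ e) &
          lambda_ e @[e --> 0^'+] --> lambda].
Proof.
have [rz0 r_z0 [J [I [IJ JI [M M0 IJM] res]]]] := A_cvg.
have I_bound (e : R) (x : H) : 0 < e -> hnorm (I e x) <= M * hnorm x.
  move=> /IJM[IM _]; apply: (opnorm_bound _ IM) => t y; exact: linearZ.
have J_bound (e : R) (u : H_ e) : 0 < e -> hnorm (J e u) <= M * hnorm u.
  move=> /IJM[_ JM]; apply: (opnorm_bound _ JM) => t y; exact: linearZ.
have IJ_cvg (tau : R) : 0 < tau -> \forall e \near 0^'+, forall u,
    dom (A_ e) u -> hnorm (I e (J e u) - u) <= tau * graph_norm (A_ e) u.
  move=> tau0; apply: filterS (cvge0_near IJ tau0) => e.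
  apply: opnorm_on_bound => [t u|u _|t u Au t0|t u Au].
  - exact: domZ.
  - by rewrite addr_ge0 ?hnorm_ge0.
  - by rewrite /graph_norm opZ// !hnormZ !hnorm_real ger0_norm// mulrDr.
  - by rewrite !linearZ/= scalerDr scalerN.
have JI_cvg (x : H) (tau : R) : 0 < tau -> \forall e \near 0^'+,
    hnorm (J e (I e x) - x) <= tau.
  move=> tau0; have /cvg_hnormP/(_ _ tau0) := JI x.
  by apply: filterS => e /ltW.
have res_cvg (tau : R) : 0 < tau -> \forall e \near 0^'+, forall f,
    hnorm (J e (resolvent (A_ e) z0 f) - resolvent A z0 (J e f)) <= tau * hnorm f.
  move=> tau0.
  apply: filterS (filterI (nbhs_right_gt 0) (cvge0_near res tau0)) => e [e0 le_tau].
  apply: (opnorm_bound _ le_tau) => t f.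
  by rewrite resolventZ ?linearZ/= ?resolventZ ?scalerBr//; exact: r_z0.
split.
- move=> conn K cK KA.
  have Kreg : K `<=` boundedness_region A_.
    move=> z /KA; rewrite -(connected_component_id rz0 conn).
    exact: (component_boundedness_region clA_ rz0 r_z0 M0 I_bound J_bound IJ_cvg res_cvg).
  have [c _ [e0 /= e00 evK]] := boundedness_region_compact cK Kreg.
  exists e0 => // e /andP[e_gt0 ee0] z Kz.
  by have [] := evK e _ e_gt0 z Kz; rewrite //= sub0r normrN gtr0_norm.
- move=> K C gamma _ _ KA_ KC _ _ _ _ z Kz; apply: contrapT => sz.
  pose c := Num.max C 1.
  have c0 : 0 < c by rewrite lt_max ltr01 orbT.
  have evn := spectrum_approx clA rz0 r_z0 M0 I_bound J_bound IJ_cvg JI_cvg res_cvg c0 sz.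
  have [e [e0 []]] := filter_ex (filterI (nbhs_right_gt 0) evn).
  split; first exact: KA_.
  apply: (@bounded_belowW _ _ _ _ C); first by rewrite le_max lexx.
  by apply: opnorm_resolvent_bounded_below; [exact: KA_|exact: KC].
move=> l /isolatedS sl [d d0 dC]; apply: (select_cvg (S := fun e => spectrum (A_ e))).
apply: (spectrum_near clA clA_ rz0 r_z0 M0 I_bound J_bound IJ_cvg JI_cvg res_cvg sl d0).
move=> w /andP[w0 wd]; apply: dC; split.
  by rewrite -ball_normE/= hnormE ltcR hdistC.
by move=> wl; move: w0; rewrite wl subrr hnorm0 ltxx.
Qed.
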